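(* Let $k,d,\lambda$ be positive integers with $d\ge\lambda$ and $k\ge\lambda+1$. Suppose $\alpha(d,\lambda)<1$ and $\frac{d}{2}\le k<\frac{2}{1-\alpha(d,\lambda)}$. Then $$m^*(k,d,\lambda)=(d-\lambda+1)+k.$$
   Context: For a finite set $X\subset\mathbb{R}^d$, a $(d-\lambda)$-plane $L$ is a complete Kneser $(d-\lambda)$-transversal of $X$ if $L$ intersects $\operatorname{conv}(K)$ for every $k$-element subset $K\subseteq X$ and $L$ contains $d-\lambda+1$ points of $X$. $m^*(k,d,\lambda)$ is the maximum positive integer $n$ such that every set of $n$ points (not necessarily in general position) in $\mathbb{R}^d$ has a complete Kneser $(d-\lambda)$-transversal to the convex hulls of its $k$-subsets. $\alpha(d,\lambda)=\frac{\lambda-1}{\lceil d/2\rceil}$. *)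

(* Defs.v *)
From mathcomp Require Export all_boot all_order all_algebra finmap.
From mathcomp Require Export boolp classical_sets reals convex.

Set Implicit Arguments.
Unset Strict Implicit.
Unset Printing Implicit Defensive.

Import Order.TTheory GRing.Theory Num.Theory.

Local Open Scope classical_set_scope.
Local Open Scope ring_scope.

(* The ambient space R^d is the space of row vectors 'rV[R]_d. *)

Definition conv_hull (R : realType) (d : nat) (A : set 'rV[R]_d) :
    set 'rV[R]_d :=
  smallest (@convex_set R 'rV[R]_d) A.

(* Affine subspaces of dimension exactly r. *)
Definition is_plane (R : realType) (d r : nat) (L : set 'rV[R]_d) : Prop :=
  exists (p : 'rV[R]_d) (V : {vspace 'rV[R]_d}),
    \dim V = r /\ L = [set x | x - p \in V].

(* L contains (at least) d - lambda + 1 distinct points of X; these need not be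
   affinely independent.  The subtraction d - lambda is truncated, so the
   notion is only meaningful for lambda <= d. *)
Definition complete_kneser_transversal (R : realType) (k d lambda : nat)
    (X : {fset 'rV[R]_d}) (L : set 'rV[R]_d) : Prop :=
  [/\ is_plane (d - lambda) L,
      (forall K : {fset 'rV[R]_d}, (K `<=` X)%fset -> #|` K| = k ->
         L `&` conv_hull [set` K] !=set0)
    & exists S : {fset 'rV[R]_d},
        [/\ (S `<=` X)%fset, #|` S| = (d - lambda + 1)%N & [set` S] `<=` L]].

Definition always_transversal (R : realType) (k d lambda : nat) : set nat :=
  [set n | (0 < n)%N /\
    forall X : {fset 'rV[R]_d}, #|` X| = n ->
      exists L, complete_kneser_transversal k lambda X L].

(* Maximum of the set above; by convention 0 (not a member of that set) when
   there is no maximum. *)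
Definition mstar (R : realType) (k d lambda : nat) : nat :=
  xget 0%N (always_transversal R k d lambda `&`
            ubound (always_transversal R k d lambda)).

Definition alpha (d lambda : nat) : rat :=
  (lambda%:R - 1) / (Num.ceil (d%:R / 2 : rat))%:~R.

(* Main.v *)
(* The hypotheses force lambda = ceil(d/2) =: m and m < k < 2m.

   Lower bound: among d + 2 points of X there is an affine dependence whose negative part has at
   most d/2 + 1 <= d - lambda + 1 points.  Complete that part to a set S of d - lambda + 1 points
   of X that misses some point with positive coefficient.  The k remaining points then have
   nonnegative coefficients, not all zero, so the dependence exhibits a point common to aff S and
   conv (X \ S); every other k-subset of X meets S.

   Upper bound: place n = d - m + 1 + k + j points, j >= 1, on the moment curve.  A (d - m)-plane L
   with d - m + 1 of these points S is aff S.  Cut the parameter line at S into m + 1 gaps (counted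
   cyclically if d is even); as k < 2m, one gap contains at most j of the k + j other points.  For
   each gap some polynomial of degree <= d vanishes on S and is positive off S and that gap:
   simple roots at the ends of the gap, double roots at the other points of S.  It is an affine
   functional vanishing on L and positive on at least k points. *)

Require Import Defs.
From mathcomp Require Import interval_inference zify ring lra.
Import Order.TTheory GRing.Theory Num.Theory.
Local Open Scope ring_scope.

(** * Polynomials with prescribed roots and signs *)

(** Take simple roots at [a], [b] and double roots at the rest of [s]: multiplying by
    [(y - a) * (y - b)] completes a square that is nonzero off [s]. *)
Lemma double_root_poly (R : realFieldType) (s : seq R) (a b : R) :
  uniq s -> a \in s -> b \in s -> a != b ->
  exists p : {poly R}, [/\ (size p <= (size s).*2.-1)%N,
    {in s, forall x, root p x} &
    forall y, y \notin s -> 0 < p.[y] * ((y - a) * (y - b))].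
Proof.
move=> us as_ bs ab.
pose q := \prod_(x <- rem b (rem a s)) ('X - x%:P).
have bra : b \in rem a s by rewrite mem_rem_uniq // !inE eq_sym ab bs.
have ms x : (x \in s) = [|| x == a, x == b | x \in rem b (rem a s)].
  by rewrite (perm_mem (perm_to_rem as_)) inE (perm_mem (perm_to_rem bra)) inE.
exists (('X - a%:P) * ('X - b%:P) * q ^+ 2); split.
- have sq : size q = (size s).-1.
    rewrite size_prod_XsubC size_rem // size_rem //.
    by have := perm_size (perm_to_rem as_); have := perm_size (perm_to_rem bra) => /=; lia.
  have s2 : (1 < size s)%N.
    by have := perm_size (perm_to_rem as_); have := perm_size (perm_to_rem bra) => /=; lia.
  apply: leq_trans (size_polyMleq _ _) _.
  have : (size (('X - a%:P) * ('X - b%:P))%R <= 3)%N.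
    by apply: leq_trans (size_polyMleq _ _) _; rewrite !size_XsubC.
  have := size_poly_exp_leq q 2; rewrite sq.
  have aux (n u v : nat) : (1 < n -> v <= (n.-2 * 2).+1 -> u <= 3 ->
    (u + v).-1 <= n.*2.-1)%N by lia.
  exact: aux.
- move=> x; rewrite ms => x_s; rewrite expr2 !rootM !root_XsubC root_prod_XsubC.
  by case/or3P: x_s => ->; rewrite ?orbT.
- move=> y; rewrite ms !negb_or => /and3P[ya yb yq].
  rewrite !hornerM !hornerXsubC.
  have -> : (y - a) * (y - b) * (q.[y] * q.[y]) * ((y - a) * (y - b)) =
            ((y - a) * (y - b) * q.[y]) ^+ 2 by ring.
  rewrite exprn_even_gt0 //= !mulf_neq0 ?subr_eq0 //.
  by rewrite -/(root q y) root_prod_XsubC.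
Qed.

(* The gaps are counted cyclically: the two unbounded ones together form gap 0. *)
Lemma cyclic_gap_poly (R : realFieldType) (m : nat) (s : seq R) :
  (0 < m)%N -> sorted <%R s -> size s = m.+1 ->
  exists gap : R -> 'I_m.+1, forall c, exists p : {poly R},
    [/\ (size p <= m.*2.+1)%N, {in s, forall x, root p x} &
        forall y, y \notin s -> gap y != c -> 0 < p.[y]].
Proof.
move=> m0 ss sz; have /andP[us sle] := lt_sorted_is_uniq_le ss.
pose N (y : R) := count (< y)%R s.
have Nlt y i : (i < N y)%N -> nth 0 s i < y by apply: nth_count_lt.
have Ngt y i : (i <= m)%N -> y \notin s -> (N y <= i)%N -> y < nth 0 s i.
  move=> im ys le; rewrite lt_neqAle nth_count_ge ?sz ?le ?ltnS ?im // andbT.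
  by apply: contraNneq ys => ->; rewrite mem_nth // sz.
have Nm y : (N y <= m.+1)%N by rewrite -sz count_size.
have nin i : (i <= m)%N -> nth 0 s i \in s by move=> im; rewrite mem_nth // sz.
exists (fun y => inord (N y %% m.+1)) => c.
have [c0|cpos] := posnP c.
  (* The ends of gap 0 are the first and last points of [s]. Points off [s] and off this gap lie
     between them, where [p] is negative, hence the witness [- p]. *)
  have [|||p [sp rp pp]] := @double_root_poly _ s (nth 0 s 0) (nth 0 s m) us.
  - exact: nin.
  - exact: nin.
  - by rewrite nth_uniq ?sz //; lia.
  exists (- p); split; first by rewrite size_polyN; apply: leq_trans sp _; rewrite sz; lia.
    by move=> x xs; rewrite rootN rp.
  move=> y ys; rewrite -val_eqE /= inordK ?ltn_pmod // c0 => Ny.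
  have Ny0 : (0 < N y)%N by case: (N y) Ny => //; rewrite mod0n.
  have Nym : (N y <= m)%N.
    have := Nm y; rewrite leq_eqVlt => /orP[/eqP e|//].
    by move: Ny; rewrite e modnn.
  have := pp y ys; have := Nlt _ _ Ny0; have := Ngt _ _ (leqnn m) ys Nym.
  rewrite hornerN => h1 h2.
  by rewrite nmulr_lgt0 ?oppr_gt0 // pmulr_rlt0 subr_cp0.
have cm : (c <= m)%N by rewrite -ltnS.
have [|||p [sp rp pp]] := @double_root_poly _ s (nth 0 s c.-1) (nth 0 s c) us.
- by apply: nin; lia.
- exact: nin.
- by rewrite nth_uniq ?sz //; lia.
exists p; split => //; first by apply: leq_trans sp _; rewrite sz; lia.
move=> y ys; rewrite -val_eqE /= inordK ?ltn_pmod // => Ny.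
have := pp y ys.
have [lt|] := ltnP (N y) c.
  have h1 := Ngt y c cm ys (ltnW lt).
  have h2 : y < nth 0 s c.-1 by apply: Ngt => //; lia.
  by rewrite pmulr_lgt0 // nmulr_rgt0 subr_lt0.
rewrite leq_eqVlt => /orP[/eqP e|gt].
  by move: Ny; rewrite -e modn_small ?eqxx // ltnS.
have h1 := Nlt y _ gt.
have h2 : nth 0 s c.-1 < y by apply: Nlt; lia.
by rewrite pmulr_lgt0 // mulr_gt0 // subr_gt0.
Qed.

(* In odd degree one more root, to the right of all points, is added and then divided out. *)
Lemma gap_poly (R : realFieldType) (d m : nat) (s : seq R) (T : R) :
  (0 < m)%N -> m = uphalf d -> sorted <%R s -> size s = (d - m + 1)%N ->
  {in s, forall x, x < T} ->
  exists gap : R -> 'I_m.+1, forall c, exists p : {poly R},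
    [/\ (size p <= d.+1)%N, {in s, forall x, root p x} &
        forall y, y \notin s -> y < T -> gap y != c -> 0 < p.[y]].
Proof.
move=> m0 md ss sz sT; case: (boolP (odd d)) => od; last first.
  have d2 : d = m.*2 by lia.
  have [|gap gP] := @cyclic_gap_poly R m s m0 ss; first by lia.
  by exists gap => c; have [p [sp rp pp]] := gP c; exists p; split; rewrite ?d2 // => y ys _; exact: pp.
have d2 : d.+1 = m.*2 by lia.
have sT' : sorted <%R (rcons s T).
  case: s ss sz sT => //= x s ss _ sT; rewrite rcons_path ss /=.
  by apply: sT; rewrite mem_last.
have [|gap gP] := @cyclic_gap_poly R m (rcons s T) m0 sT'.
  by rewrite size_rcons sz; lia.
exists gap => c; have [p [sp rp pp]] := gP c.
have /factor_theorem[q qE] : root p T by rewrite rp // mem_rcons mem_head.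
(* Left of [T] the factor ['X - T%:P] is negative, so dividing it out flips the sign. *)
exists (- q); split.
- rewrite size_polyN; have [->|q0] := eqVneq q 0; first by rewrite size_poly0.
  by move: sp; rewrite qE size_Mmonic ?monicXsubC // size_XsubC addn2 d2 -ltnS.
- move=> x xs; have := rp x; rewrite mem_rcons inE xs orbT => /(_ isT).
  by rewrite rootN qE rootM root_XsubC lt_eqF ?orbF // sT.
- move=> y ys yT yc; have := pp y; rewrite mem_rcons inE negb_or (lt_eqF yT) ys.
  move=> /(_ isT yc); rewrite qE hornerM hornerXsubC hornerN nmulr_lgt0 ?subr_lt0 //.
  by rewrite oppr_gt0.
Qed.

(** * The moment curve and affine functionals *)

Definition moment (R : realType) (d : nat) (t : R) : 'rV[R]_d :=
  \row_(i < d) t ^+ i.+1.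

(* The affine functional whose pullback along the moment curve is [p]. *)
Definition poly_functional {R : realType} {d : nat} (p : {poly R}) (x : 'rV[R]_d) : R :=
  p`_0 + (x *m \col_(i < d) p`_i.+1) 0 0.

Lemma poly_functional_moment (R : realType) (d : nat) (p : {poly R}) (t : R) :
  (size p <= d.+1)%N -> poly_functional p (moment R d t) = p.[t].
Proof.
move=> sp; rewrite (horner_coef_wide t sp) big_ord_recl expr0 mulr1; congr (_ + _).
by rewrite mxE; apply: eq_bigr => i _; rewrite !mxE mulrC.
Qed.

Lemma poly_functional_sum (R : realType) (d : nat) (p : {poly R}) (x : 'rV[R]_d)
    (I : finType) (a : I -> R) (u v : I -> 'rV[R]_d) :
  poly_functional p (x + \sum_i a i *: (u i - v i)) =
  poly_functional p x +
  \sum_i a i * (poly_functional p (u i) - poly_functional p (v i)).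
Proof.
rewrite /poly_functional mulmxDl mxE addrA; congr (_ + _).
rewrite mulmx_suml summxE; apply: eq_bigr => i _.
rewrite -scalemxAl mxE mulmxBl mxE [X in _ + X]mxE; ring.
Qed.

Lemma moment_inj (R : realType) (d : nat) : (0 < d)%N -> injective (moment R d).
Proof.
by case: d => // d _ t u /rowP/(_ ord0); rewrite !mxE.
Qed.

(** As [conv_hull] is the smallest convex superset, this half-space contains the hull of any points
    on which the functional is positive. *)
Lemma convex_poly_functional_gt0 (R : realType) (d : nat) (p : {poly R}) :
  @convex_set R 'rV[R]_d [set x | 0 < poly_functional p x]%classic.
Proof.
move=> x y l; rewrite !inE => x0 y0.
move: x0 y0 => /= x0 y0; rewrite [ltRHS](_ : _ =
    l%:num * poly_functional p x + (1 - l%:num) * poly_functional p y); last first.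
  rewrite /poly_functional /conv /= mulmxDl -!scalemxAl !mxE /=.
  rewrite /unstable.onem; ring.
have l0 : 0 <= l%:num :> R by [].
have l1 : l%:num <= 1 :> R by [].
nra.
Qed.

(* Distinct points of the moment curve are affinely independent, so [L] is spanned by them. *)
Lemma poly_functional_plane (R : realType) (d r : nat) (L : set 'rV[R]_d)
    (s : seq R) (p : {poly R}) :
  is_plane r L -> uniq s -> size s = r.+1 -> (r <= d)%N ->
  {in s, forall t, L (moment R d t)} ->
  (size p <= d.+1)%N -> {in s, forall t, root p t} ->
  forall x, L x -> poly_functional p x = 0.
Proof.
move=> [q [V [dV ->]]]; case: s => [|t0 s] // us [sz] rd sL sp rp x /= xV.
have VB u v : u - q \in V -> v - q \in V -> u - v \in V.
  by move=> uV vV; rewrite -(subrKA q) rpredD // -opprB rpredN.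
pose X := [tuple moment R d s`_i - moment R d t0 | i < r].
have XE (i : 'I_r) : X`_i = moment R d s`_i - moment R d t0.
  by rewrite (nth_map i) ?size_enum_ord // nth_ord_enum.
have t0V : moment R d t0 - q \in V by apply: (sL t0); rewrite mem_head.
have nin (i : 'I_r) : s`_i \in s by rewrite mem_nth // sz.
have XV (i : 'I_r) : X`_i \in V.
  by rewrite XE VB //; apply: (sL s`_i); rewrite inE nin orbT.
have fX : free X.
  apply/freeP => k k0 i.
  pose l := \prod_(t <- rem s`_i (t0 :: s)) ('X - t%:P).
  have sl : (size l <= d.+1)%N.
    by rewrite size_prod_XsubC size_rem ?inE ?nin ?orbT //= sz ltnS.
  have rl t : t \in t0 :: s -> root l t = (t != s`_i).
    by move=> ts; rewrite root_prod_XsubC mem_rem_uniq // !inE -in_cons ts andbT.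
  have := poly_functional_sum R d l (moment R d t0) _ k
    (fun i => moment R d s`_i) (fun _ => moment R d t0).
  under eq_bigr do rewrite -XE; rewrite k0 addr0 => /eqP.
  rewrite eq_sym -subr_eq0 addrC addKr (bigD1 i) //= big1 ?addr0; last first.
    move=> j ji; rewrite !poly_functional_moment //.
    rewrite (rootP (_ : root l s`_j)) ?(rootP (_ : root l t0)) ?subrr ?mulr0 //.
      by rewrite rl ?mem_head //; move: us => /= /andP[+ _]; apply: contraNneq => ->.
    rewrite rl ?inE ?nin ?orbT // nth_uniq ?sz //; by case/andP: us.
  have t0l : root l t0.
    by rewrite rl ?mem_head //; move: us => /= /andP[+ _]; apply: contraNneq => ->.
  rewrite !poly_functional_moment // (rootP t0l) subr0 mulf_eq0 => /orP[/eqP//|].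
  by rewrite -/(root l _) rl ?inE ?nin ?orbT // eqxx.
have spanX : <<X>>%VS = V.
  apply/eqP; rewrite eqEdim (eqP (_ : \dim <<X>> == r)%N) ?dV ?leqnn ?andbT; last first.
    by move: fX; rewrite /free size_tuple.
  by apply/span_subvP => v /tnthP[i ->]; rewrite (tnth_nth 0).
have : x - moment R d t0 \in <<X>>%VS.
  by rewrite spanX VB.
move=> /coord_span; under eq_bigr do rewrite XE.
move/eqP; rewrite subr_eq addrC => /eqP ->.
rewrite poly_functional_sum poly_functional_moment // (rootP (rp _ (mem_head _ _))) add0r.
rewrite big1 // => i _; rewrite !poly_functional_moment //.
by rewrite (rootP (rp s`_i _)) ?subrr ?mulr0 // inE nin orbT.
Qed.

(** * Upper bound: points on the moment curve *)

Lemma pigeonhole_seq (T : eqType) (m j : nat) (color : T -> 'I_m.+1) (s : seq T) :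
  (size s < m.+1 * j.+1)%N ->
  exists c, (count (fun x => color x == c) s <= j)%N.
Proof.
move=> sm; apply/existsP; apply: contraTT sm; rewrite negb_exists => /forallP all_gt.
rewrite -leqNgt -[size s]sum1_size (partition_big color xpredT) //=.
rewrite -[X in (X * _)%N](card_ord m.+1) -sum_nat_const; apply: leq_sum => c _.
by rewrite sum1_count ltnNge.
Qed.

Lemma moment_curve_no_transversal (R : realType) (k d m n : nat) :
  (0 < m)%N -> m = uphalf d -> (k < m.*2)%N -> (d - m + 1 + k < n)%N ->
  exists X : {fset 'rV[R]_d}, #|` X| = n /\
    forall L, ~ complete_kneser_transversal k m X L.
Proof.
move=> m0 md km nd; have d0 : (0 < d)%N by lia.
pose ts : seq R := [seq i%:R | i <- iota 0 n].
have ts_lt : sorted <%R ts.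
  rewrite sorted_map; apply: sub_sorted (iota_ltn_sorted 0 n) => i j /=.
  by rewrite ltr_nat.
have uts := lt_sorted_uniq ts_lt.
have inj := @moment_inj R d d0.
have card_im (s : seq R) : uniq s -> #|` [fset x in map (moment R d) s]%fset| = size s.
  by move=> us; rewrite card_fseq undup_id ?map_inj_uniq // size_map.
exists [fset x in map (moment R d) ts]%fset; split.
  by rewrite card_im // size_map size_iota.
move=> L [planeL cross [S [SX cS SL]]].
pose s := [seq t <- ts | moment R d t \in S].
pose Y := [seq t <- ts | moment R d t \notin S].
have us : uniq s by rewrite filter_uniq.
have sE : S = [fset x in map (moment R d) s]%fset.
  apply/fsetP => x; rewrite inE; apply/idP/mapP => [xS|[t + ->]]; last first.
    by rewrite mem_filter => /andP[].
  have := fsubsetP SX x xS; rewrite inE => /mapP[t tts xt].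
  by exists t => //; rewrite mem_filter -xt xS.
have sz : size s = (d - m + 1)%N by rewrite -card_im // -sE.
have sY : (size s + size Y)%N = n.
  by rewrite !size_filter count_predC size_map size_iota.
have ts_n : {in ts, forall x, x < n%:R :> R}.
  by move=> x /mapP[i]; rewrite mem_iota => /andP[_ ?] ->; rewrite ltr_nat.
have [||gap gapP] := @gap_poly R d m s n%:R m0 md _ sz.
- by apply: sorted_filter ts_lt; exact: lt_trans.
- by move=> x; rewrite mem_filter => /andP[_ /ts_n].
(* With [j = size Y - k], the condition [k + j < (m + 1) * (j + 1)] reads [k <= m * (j + 1)]. It
   follows from [k < 2 * m] since [j >= 1]. *)
have [|c cP] := @pigeonhole_seq _ m (size Y - k)%N gap Y.
  by move: (size Y) sY => y; rewrite sz; nia.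
have [p [sp rp pp]] := gapP c.
pose Z := [seq y <- Y | gap y != c].
have kZ : (k <= size Z)%N.
  have : (count (fun y => gap y == c) Y + size Z = size Y)%N.
    by rewrite size_filter count_predC.
  by move: (size Y) (size Z) (count _ _) sY cP => y z u; rewrite sz; lia.
have uZ : uniq (take k Z) by rewrite take_uniq // !filter_uniq.
have tZ t : t \in take k Z -> [/\ t \in ts, moment R d t \notin S & gap t != c].
  by move/mem_take; rewrite !mem_filter => /and3P[].
(* These [k] points avoid both [S] and gap [c], so their hull lies where the functional of [p] is
   positive, while it vanishes on [L]. *)
have := cross [fset x in map (moment R d) (take k Z)]%fset.
case.
- apply/fsubsetP => x; rewrite !inE => /mapP[t /tZ[tts _ _] ->].
  by rewrite map_f.
- by rewrite card_im // size_takel.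
move=> x [xL xK].
have x0 : poly_functional p x = 0.
  apply: (poly_functional_plane R d (d - m) L s) => //; first by rewrite sz addn1.
    by rewrite leq_subr.
  by move=> t; rewrite mem_filter => /andP[/SL].
have : 0 < poly_functional p x.
  apply: (smallest_sub (@convex_poly_functional_gt0 R d p) _ xK).
  move=> y /=; rewrite inE => /mapP[t /tZ[tts tS tc] ->].
  rewrite poly_functional_moment // pp ?ts_n //.
  by rewrite mem_filter negb_and tS.
by rewrite x0 ltxx.
Qed.

(** * Lower bound: affine dependences and transversals *)

(** The weights are not normalized, so that coefficients of an affine dependence can be used
    directly. The induction mixes the head with the normalized tail. *)
Lemma convex_combination (R : realType) (d : nat) (C : set 'rV[R]_d)
    (a : 'rV[R]_d -> R) (s : seq 'rV[R]_d) :
  @convex_set R 'rV[R]_d C -> {in s, forall x, 0 <= a x} ->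
  {in s, forall x, C x} -> 0 < \sum_(x <- s) a x ->
  C ((\sum_(x <- s) a x)^-1 *: \sum_(x <- s) a x *: x).
Proof.
move=> cC; elim: s => [|x s IH] a0 sC; first by rewrite big_nil ltxx.
rewrite !big_cons; set A := \sum_(y <- s) a y; set v := \sum_(y <- s) _.
have ax0 : 0 <= a x by rewrite a0 ?mem_head.
have sa0 : {in s, forall y, 0 <= a y} by move=> y ys; rewrite a0 // inE ys orbT.
have A0 : 0 <= A by rewrite /A big_seq sumr_ge0.
have Cx : C x by apply: sC; rewrite mem_head.
(* A tail of total weight 0 cannot be normalized, but then all its weights vanish and only [x]
   remains. *)
move=> pos; have [A_eq0|A_neq0] := eqVneq A 0.
  have -> : v = 0.
    rewrite /v big_seq big1 // => y ys.
    have : \sum_(y <- s) a y == 0 by rewrite -/A A_eq0.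
    rewrite big_seq psumr_eq0 //.
    by move=> /allP/(_ y ys); rewrite ys => /eqP ->; rewrite scale0r.
  rewrite addr0 A_eq0 addr0 scalerA mulVf ?scale1r //.
  by move: pos; rewrite A_eq0 addr0 => /gt_eqF ->.
have A_gt0 : 0 < A by rewrite lt_neqAle eq_sym A_neq0.
have t0 : 0 <= a x / (a x + A) by rewrite divr_ge0 // ltW.
have t1 : a x / (a x + A) <= 1 by rewrite ler_pdivrMr // mul1r lerDl.
have Cv : C (A^-1 *: v) by apply: IH => // y ys; apply: sC; rewrite inE ys orbT.
have := cC x (A^-1 *: v) (Itv01 t0 t1); rewrite !inE => /(_ Cx Cv).
congr C; rewrite /conv /= /unstable.onem scalerDr !scalerA mulrC; congr (_ + _ *: _).
by field; rewrite A_neq0 gt_eqF.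
Qed.

(** The rows [(1, x)] live in dimension [d + 1], so they are linearly dependent. The leading
    coordinate makes the coefficients sum to 0. *)
Lemma affine_dependence (R : fieldType) (d : nat) (s : seq 'rV[R]_d) :
  uniq s -> (d.+1 < size s)%N ->
  exists a : 'rV[R]_d -> R, [/\ \sum_(x <- s) a x = 0,
    \sum_(x <- s) a x *: x = 0 & exists2 x, x \in s & a x != 0].
Proof.
move=> us sd; set n := size s in sd.
pose M : 'M[R]_(n, 1 + d) := \matrix_(i < n) row_mx 1 s`_i.
have kM : kermx M != 0.
  rewrite -mxrank_eq0 mxrank_ker; have := rank_leq_col M; lia.
have /rowV0Pn[v /sub_kermxP vM v0] := kM.
have n0 : (0 < n)%N by apply: leq_ltn_trans sd.
(* The default index [Ordinal n0] only affects points outside [s]. *)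
pose a x := v 0 (insubd (Ordinal n0) (index x s)).
have aE (i : 'I_n) : a s`_i = v 0 i.
  by rewrite /a index_uniq //; congr (v 0 _); apply/val_inj; rewrite val_insubd ltn_ord.
have sumE (V : nmodType) (F : R -> 'rV[R]_d -> V) :
    \sum_(x <- s) F (a x) x = \sum_(i < n) F (v 0 i) s`_i.
  by rewrite (big_nth 0) big_mkord; apply: eq_bigr => i _; rewrite aE.
have vM0 : \sum_(i < n) v 0 i *: row_mx (1 : 'M_1) s`_i = 0.
  by rewrite -[RHS]vM mulmx_sum_row; under [RHS]eq_bigr do rewrite rowK.
exists a; split.
- rewrite (sumE _ (fun c _ => c)); move/(congr1 (fun w : 'rV__ => w 0 (lshift d 0))): vM0.
  rewrite summxE mxE => h; rewrite -[RHS]h; apply: eq_bigr => i _.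
  by rewrite mxE row_mxEl mxE eqxx mulr1.
- rewrite (sumE _ (fun c x => c *: x)); apply/rowP => j.
  move/(congr1 (fun w : 'rV__ => w 0 (rshift 1 j))): vM0.
  rewrite !summxE !mxE => h; rewrite -[RHS]h; apply: eq_bigr => i _.
  by rewrite mxE [RHS]mxE row_mxEr.
- have /rV0Pn[i vi] := v0.
  by exists s`_i; rewrite ?mem_nth ?aE.
Qed.

Lemma sumr_eq0_gt0 (R : realDomainType) (T : eqType) (s : seq T) (a : T -> R) (x : T) :
  \sum_(y <- s) a y = 0 -> x \in s -> a x != 0 -> exists2 y, y \in s & 0 < a y.
Proof.
move=> sum0 xs ax; apply/hasP; apply: contraNT ax => /hasPn h.
have : \sum_(y <- s) - a y == 0 by rewrite sumrN sum0 oppr0.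
rewrite big_seq psumr_eq0; last by move=> y /h; rewrite -leNgt oppr_ge0.
by move=> /allP/(_ x xs); rewrite xs oppr_eq0.
Qed.

(* Radon: of the two parts of an affine dependence on d + 2 points, the smaller has at most
   d/2 + 1 points; the sign is chosen so that it is the negative one. *)
Lemma unbalanced_affine_dependence (R : realType) (d : nat) (s : seq 'rV[R]_d) :
  uniq s -> size s = d.+2 ->
  exists a : 'rV[R]_d -> R, [/\ \sum_(x <- s) a x = 0,
    \sum_(x <- s) a x *: x = 0, exists2 x, x \in s & 0 < a x &
    (count (fun x => a x < 0)%R s <= d./2.+1)%N].
Proof.
move=> us sz; have [|a [sum0 comb0 [x xs ax]]] := @affine_dependence R d s us.
  by rewrite sz.
have cnt : (count (fun x => a x < 0)%R s + count (fun x => 0 < a x)%R s <= d.+2)%N.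
  rewrite -sz -(count_predC (fun x => a x < 0)%R) leq_add2l.
  by apply: sub_count => y /= ay; rewrite -leNgt ltW.
have [lt|gt] := leqP (count (fun x => a x < 0)%R s) d./2.+1.
  by exists a; split=> //; apply: sumr_eq0_gt0 sum0 xs ax.
have sum0' : \sum_(y <- s) - a y = 0 by rewrite sumrN sum0 oppr0.
exists (fun x => - a x); split => //.
- by under eq_bigr do rewrite scaleNr; rewrite sumrN comb0 oppr0.
- by apply: sumr_eq0_gt0 sum0' xs _; rewrite oppr_eq0.
- under eq_count do rewrite oppr_lt0; move: (count _ _) (count _ _) cnt gt => u v; lia.
Qed.

(** Keep the first [r] vectors of a basis of [U] followed by one of a complement. *)
Lemma vspace_extend (K : fieldType) (vT : vectType K) (U : {vspace vT}) (r : nat) :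
  (\dim U <= r <= \dim {:vT})%N -> exists2 V : {vspace vT}, (U <= V)%VS & \dim V = r.
Proof.
move=> /andP[Ur rd].
pose b := vbasis U ++ vbasis U^C%VS.
have fb : basis_of (U + U^C) b.
  apply: cat_basis (vbasisP _) (vbasisP _).
  by apply/directv_addP; exact: capv_compl.
have sb : size b = \dim {:vT}.
  by rewrite -(addv_complf U) (@size_basis _ _ _ _ (in_tuple b) fb).
exists <<take r b>>%VS.
  rewrite -{1}(span_basis (vbasisP U)); apply: sub_span => x xU.
  by rewrite take_cat size_tuple ltnNge Ur /= mem_cat xU.
have : free (take r b).
  by move: (basis_free fb); rewrite -{1}(cat_take_drop r b) => /catl_free.
by rewrite /free size_takel ?sb // => /eqP.
Qed.

(** The points may be affinely dependent, so the span of their differences is enlarged to dimension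
    exactly [r], as [is_plane] requires. *)
Lemma plane_through (R : realType) (d r : nat) (s : seq 'rV[R]_d) :
  size s = r.+1 -> (r <= d)%N -> exists (p : 'rV[R]_d) (V : {vspace 'rV[R]_d}),
    \dim V = r /\ {in s, forall x, x - p \in V}.
Proof.
case: s => // p s [sz] rd.
have [|V UV dV] := @vspace_extend R 'rV[R]_d <<[seq x - p | x <- s]>>%VS r.
  by rewrite dimvf /dim /= mul1n rd andbT (leq_trans (dim_span _)) // size_map sz.
exists p, V; split=> // x; rewrite inE => /predU1P[->|xs]; first by rewrite subrr rpred0.
by apply: (subvP UV); apply: memv_span; rewrite (map_f (fun x => x - p)).
Qed.

Lemma complete_transversal_exists (R : realType) (k d lambda : nat) :
  (lambda <= d)%N -> (lambda <= uphalf d)%N -> (lambda < k)%N ->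
  forall X : {fset 'rV[R]_d}, #|` X| = (d - lambda + 1 + k)%N ->
  exists L, complete_kneser_transversal k lambda X L.
Proof.
move=> ld lu lk X cX; set r := (d - lambda)%N.
pose xs := enum_fset X; have uxs : uniq xs := fset_uniq X.
have sxs : size xs = (r + 1 + k)%N := cX.
(* There are at least [d + 2] points because [lambda < k]. *)
pose s := take d.+2 xs; have us : uniq s by rewrite take_uniq.
have [|a [sum0 comb0 [y ys ay] neg]] := @unbalanced_affine_dependence R d s us.
  by rewrite size_takel // sxs /r; lia.
pose b x := if x \in s then a x else 0.
have sum_b (V : nmodType) (F : R -> 'rV[R]_d -> V) : (forall x, F 0 x = 0) ->
    \sum_(x <- xs) F (b x) x = \sum_(x <- s) F (a x) x.
  move=> F0; rewrite -[in LHS](cat_take_drop d.+2 xs) big_cat /= -/s.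
  rewrite [X in _ + X]big_seq [X in _ + X]big1 => [|x xd].
    by rewrite addr0; apply: eq_big_seq => x xs'; rewrite /b xs'.
  rewrite /b ifN //; move: uxs; rewrite -[in X in X -> _](cat_take_drop d.+2 xs) cat_uniq.
  by case/and3P => _ /hasPn/(_ x xd).
pose N := [seq x <- s | a x < 0].
pose t := [seq x <- xs | (x != y) && (x \notin N)].
have sNt : size (N ++ t) = (r + k)%N.
  suff /perm_size : perm_eq (y :: N ++ t) xs by rewrite sxs /= addnAC addn1 => -[].
  apply: uniq_perm => //=.
    rewrite mem_cat !mem_filter eqxx ltNge (ltW ay) /= cat_uniq !filter_uniq // andbT /=.
    by apply/hasPn => x; rewrite mem_filter => /andP[/andP[_ xN] _].
  move=> x; rewrite inE mem_cat !mem_filter negb_and.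
  have [->|xy] := eqVneq x y; first by rewrite (mem_take ys).
  have [xs'|] := boolP (x \in s); first by rewrite (mem_take xs') !andbT orbF orbN.
  by rewrite andbF orbT.
(* Listing [N] first puts every negative point into [S]; [y] is left out of the list, so a positive
   weight survives in [C]. *)
pose S := take r.+1 (N ++ t); pose C := [seq x <- xs | x \notin S].
have uS : uniq S.
  rewrite take_uniq // cat_uniq !filter_uniq // andbT /=.
  by apply/hasPn => x; rewrite mem_filter => /andP[/andP[_ xN] _].
have sS : size S = r.+1 by rewrite size_takel // sNt; lia.
have Sxs x : x \in S -> x \in xs.
  move/mem_take; rewrite mem_cat !mem_filter => /orP[/andP[_ /mem_take //]|/andP[] //].
have perm_SC : perm_eq xs (S ++ C).
  apply: uniq_perm => //.
    rewrite cat_uniq uS filter_uniq // andbT /=.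
    by apply/hasPn => x; rewrite mem_filter => /andP[].
  move=> x; rewrite mem_cat mem_filter; have [/Sxs->//|] := boolP (x \in S).
  by [].
have sC : size C = k.
  by have := perm_size perm_SC; rewrite size_cat sxs sS addn1 => /addnI.
have NS x : x \in N -> x \in S.
  move=> xN; rewrite /S take_cat; case: ltnP => [lt|_]; last by rewrite mem_cat xN.
  (* [N] fits into [S]: [d./2 + 1 <= r + 1] since [lambda <= uphalf d]. *)
  exfalso; move: lt; rewrite size_filter; move: (count _ _) neg => c; lia.
have bC : {in C, forall x, 0 <= b x}.
  move=> x; rewrite mem_filter /b => /andP[xS _]; case: ifP => // xs'.
  rewrite leNgt; apply: contra xS => ax; apply: NS.
  by rewrite mem_filter ax.
have yC : y \in C.
  rewrite mem_filter (mem_take ys) andbT; apply: contraL ay => /mem_take.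
  by rewrite mem_cat !mem_filter eqxx /= orbF => /andP[/ltW]; rewrite leNgt.
have A_gt0 : 0 < \sum_(x <- C) b x.
  rewrite (big_rem y yC) /=; apply: ltr_pwDl; first by rewrite /b ys.
  by rewrite big_seq sumr_ge0 // => x /mem_rem/bC.
have [|p [V [dV SV]]] := @plane_through R d r S sS; first exact: leq_subr.
set A := \sum_(x <- C) b x in A_gt0.
pose z := A^-1 *: \sum_(x <- C) b x *: x.
have zV : z - p \in V.
  have -> : z - p = A^-1 *: \sum_(x <- C) b x *: (x - p).
    under eq_bigr do rewrite scalerBr.
    by rewrite sumrB -scaler_suml scalerBr scalerA mulVf ?scale1r // gt_eqF.
  (* The dependence trades the sum over [C] for minus the sum over [S], whose terms lie in [V]. *)
  have : \sum_(x <- xs) b x *: (x - p) = 0.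
    rewrite (sum_b _ (fun c x => c *: (x - p))); last by move=> x; rewrite scale0r.
    under eq_bigr do rewrite scalerBr.
    by rewrite sumrB -scaler_suml sum0 scale0r comb0 subrr.
  rewrite (perm_big _ perm_SC) big_cat /= => /eqP; rewrite addrC addr_eq0 => /eqP ->.
  rewrite rpredZ // rpredN big_seq rpred_sum // => x xS.
  by rewrite rpredZ // SV.
exists [set x | x - p \in V]%classic; split.
- by exists p, V.
- move=> K KX cK.
  have [/hasP[x xK xS]|/hasPn KS] := boolP (has (mem S) (enum_fset K)).
    by exists x; split; [exact: SV | apply: sub_gen_smallest].
  (* A [k]-subset missing [S] lies in [C], which has [k] points, so it is all of [C], and [z] is in
     its hull. *)
  have KC : {subset enum_fset K <= C}.
    by move=> x xK; rewrite mem_filter KS //; apply: (fsubsetP KX).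
  have [_ KCE] := uniq_min_size (fset_uniq K) KC (eq_leq (etrans sC (esym cK))).
  exists z; split=> // M [cM KM]; apply: convex_combination => // x xC.
  by apply: KM; rewrite /= -KCE in xC *.
- exists [fset x in S]%fset; split.
  + by apply/fsubsetP => x; rewrite inE => /Sxs.
  + by rewrite card_fseq undup_id // sS addn1.
  + by move=> x /=; rewrite inE => /SV.
Qed.

(** * Arithmetic of the hypotheses and conclusion *)

(** With [u = uphalf d], the bounds become [lambda <= u <= k] and [k * (u - lambda + 1) < 2 * u]. If
    [lambda < u], the left side would be at least [2 * u]. *)
Lemma alpha_bounds (k d lambda : nat) :
  (0 < d)%N -> (0 < lambda)%N ->
  alpha d lambda < 1 -> (d%:R / 2 : rat) <= k%:R ->
  (k%:R : rat) < 2 / (1 - alpha d lambda) ->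
  lambda = uphalf d /\ (k < lambda.*2)%N.
Proof.
move=> d0 l0; set u := uphalf d.
have dE : (d%:R : rat) = 2 * u%:R - (odd d)%:R.
  have e : (2 * u = d + odd d)%N by rewrite /u; lia.
  by rewrite -natrM e natrD addrK.
have u0 : (0 : rat) < u%:R by rewrite ltr0n /u; lia.
have cE : Num.ceil (d%:R / 2 : rat) = u%:Z.
  apply: ceil_def; rewrite rmorphB /= -pmulrn dE.
  by case: (odd d) => /=; apply/andP; split; lra.
rewrite /alpha cE -pmulrn ltr_pdivrMr // mul1r => lu.
have {}lu : (lambda <= u)%N.
  by rewrite -ltnS -(ltr_nat rat) -natr1; lra.
rewrite dE => uk.
have {}uk : (u <= k)%N.
  rewrite -ltnS -(ltr_nat rat) -natr1.
  have : ((odd d)%:R : rat) <= 1 by case: (odd d).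
  by move=> h; lra.
have u_neq0 : (u%:R : rat) != 0 by rewrite gt_eqF.
have lQ : (lambda%:R : rat) <= u%:R by rewrite ler_nat.
have -> : 2 / (1 - (lambda%:R - 1) / u%:R) = 2 * u%:R / (u%:R - lambda%:R + 1) :> rat.
  by field; rewrite u_neq0 andbT lt0r_neq0 //; lra.
rewrite ltr_pdivlMr; last by lra.
rewrite -natrB // natr1 -!natrM ltr_nat => kb.
by split; nia.
Qed.

Theorem theorem4 (R : realType) (k d lambda : nat)
    (hk : (0 < k)%N) (hd : (0 < d)%N) (hlambda : (0 < lambda)%N)
    (hdl : (lambda <= d)%N) (hkl : (lambda + 1 <= k)%N)
    (halpha : alpha d lambda < 1)
    (hdk : (d%:R / 2 : rat) <= k%:R)
    (hka : (k%:R : rat) < 2 / (1 - alpha d lambda)) :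
  mstar R k d lambda = ((d - lambda + 1) + k)%N.
Proof.
have [lE kl] := @alpha_bounds k d lambda hd hlambda halpha hdk hka.
have always : always_transversal R k d lambda (d - lambda + 1 + k)%N.
  split; first by lia.
  by move=> X; apply: complete_transversal_exists; rewrite ?lE //; lia.
have bound n : always_transversal R k d lambda n -> (n <= d - lambda + 1 + k)%N.
  move=> [_ alwaysn]; rewrite leqNgt; apply/negP => nlt.
  have [X [cX noL]] := moment_curve_no_transversal R k d lambda n hlambda lE kl nlt.
  by have [L /noL] := alwaysn X cX.
(* The bound is attained, so the maximum exists and [xget] does not fall back on its default 0. *)
apply: xget_unique; first by split=> // n /bound.
move=> n [/bound nle /(_ _ always) nge].
by apply/eqP; rewrite eqn_leq nle.
Qed.
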